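(* The following identities hold: $$ {}_4F_3\left(1,1,1,\tfrac{3}{2};\tfrac{5}{2},\tfrac{5}{2},\tfrac{5}{2};1\right)=27\sum_{n\geq 0}\frac{16^n}{(2n+3)^3 (2n+1)^2 \binom{2n}{n}^2}=\frac{27}{2}\left(7\,\zeta(3)+(3-2G)\,\pi-12\right), $$ where $\zeta(3)=\sum_{n\geq 1}\frac{1}{n^3}$ and $G=\sum_{n\geq 0}\frac{(-1)^n}{(2n+1)^2}$ is Catalan's constant.
   Context: The hypergeometric function is defined by the series ${}_4F_3(a,b,c,d;e,f,g;z)=\sum_{n\geq 0}\frac{(a)_n(b)_n(c)_n(d)_n}{n!\,(e)_n(f)_n(g)_n}\,z^n$, where $(a)_n=\frac{\Gamma(a+n)}{\Gamma(a)}$ is the rising factorial (Pochhammer symbol). *)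

(* Defs.v *)
(* Stdlib real numbers with Coquelicot. *)
From Stdlib Require Import Arith Reals.
From Coquelicot Require Import Coquelicot.
Open Scope R_scope.

(* Euler's integral of the second kind.  It represents the Gamma function for
   [0 < x] only; for [x <= 0] the integral diverges and the value is
   meaningless. *)
Definition Gamma (x : R) : R :=
  RInt_gen (fun t => Rpower t (x - 1) * exp (- t))
           (at_right 0) (Rbar_locally p_infty).

(* Meaningful for [0 < a], as [Gamma] is. *)
Definition pochhammer (a : R) (n : nat) : R := Gamma (a + INR n) / Gamma a.

Definition hyp4F3_term (a b c d e f g z : R) (n : nat) : R :=
  (pochhammer a n * pochhammer b n * pochhammer c n * pochhammer d n)
  / (INR (fact n) * pochhammer e n * pochhammer f n * pochhammer g n) * z ^ n.

Definition hyp4F3 (a b c d e f g z : R) : R :=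
  Series (hyp4F3_term a b c d e f g z).

(* The index is shifted: the series starts at n = 1. *)
Definition zeta3 : R := Series (fun n => 1 / INR (S n) ^ 3).

Definition Catalan : R := Series (fun n => (-1) ^ n / (2 * INR n + 1) ^ 2).

(* [Binomial.C m k] is the real-valued binomial coefficient; the bare name [C]
   is Coquelicot's type of complex numbers. *)
Definition binom_term (n : nat) : R :=
  16 ^ n / ((2 * INR n + 3) ^ 3 * (2 * INR n + 1) ^ 2
            * Binomial.C (2 * n) n ^ 2).

(* Main.v *)
(* Put w_n = 4^n / ((2n+1) binom(2n,n)) = int_0^(pi/2) sin^(2n+1).  The functional
   equation of Gamma turns the hypergeometric term into 27 w_n^2 / (2n+3)^3, and
   since w_(n+1) = w_n (2n+2)/(2n+3) the partial sums of w_n^2 / (2n+3)^3 differ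
   from those of w_n^2 / (2n+1) by a telescoping quantity whose limit, 3 pi/2 - 6,
   is Wallis's.  From s / sin s = sum w_n sin^(2n) s cos s one gets
     sum w_n^2 / (2n+1) = int_0^(pi/2) (pi/2 - s) s / sin s ds,
   and expanding 1 / sin s by 2 sum_(k<N) sin((2k+1) s) = (1 - cos 2Ns) / sin s
   evaluates the integral as 4 sum 1/(2k+1)^3 - pi G = 7/2 zeta(3) - pi G.
   Only the difference of the two truncated integrands is integrated; they are
   smooth, so the singularity of s / sin s at 0 never has to be removed. *)
Require Import Defs.
From Stdlib Require Import Arith Reals Lra Lia.
From Coquelicot Require Import Coquelicot.
Open Scope R_scope.

(** * Euler's integral: convergence and functional equation *)

Definition is_Gamma (x l : R) : Prop :=
  is_RInt_gen (fun t => Rpower t (x - 1) * exp (- t))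
    (at_right 0) (Rbar_locally p_infty) l.

(** [Gamma] has a value even where its integral diverges, so the work is done with [is_Gamma], which
    includes convergence, and transferred here. *)
Lemma is_Gamma_unique (x l : R) : is_Gamma x l -> Gamma x = l.
Proof. intros H; unfold Gamma; exact (is_RInt_gen_unique _ _ H). Qed.

Lemma filter_prod_pos (P : R * R -> Prop) :
  (forall a b, 0 < a < b -> P (a, b)) ->
  filter_prod (at_right 0) (Rbar_locally p_infty) P.
Proof.
  intros HP.
  apply (Filter_prod _ _ _ (fun a => 0 < a < 1) (fun b => 1 < b)).
  - exists (mkposreal 1 Rlt_0_1); intros y Hy Hy0; split; [exact Hy0|].
    apply Rabs_lt_between in Hy; unfold minus, plus, opp in Hy; simpl in Hy; lra.
  - exists 1; intros y Hy; exact Hy.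
  - intros a b Ha Hb; apply HP; lra.
Qed.


Lemma continuous_at_right (f : R -> R) (x : R) :
  continuous f x -> filterlim f (at_right x) (locally (f x)).
Proof.
  apply (filterlim_filter_le_1 (F := locally x) (G := at_right x) f).
  apply (filter_le_within (F := locally x)).
Qed.

Lemma exp_le_compat (x y : R) : x <= y -> exp x <= exp y.
Proof.
  intros [H| ->]; [left; apply exp_increasing, H|apply Rle_refl].
Qed.

(** For [0 < t < 1] and [1 <= x] the function is squeezed between 0 and [t]. *)
Lemma Rpower_exp_at_right_0 (x : R) :
  1 <= x -> filterlim (fun t => Rpower t x * exp (- t)) (at_right 0) (locally 0).
Proof.
  intros Hx; apply filterlim_locally; intros eps.
  assert (Hd : 0 < Rmin 1 eps) by (apply Rmin_pos; [lra|apply cond_pos]).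
  exists (mkposreal _ Hd); intros t Ht Ht0.
  apply Rabs_lt_between in Ht; unfold minus, plus, opp in Ht; simpl in Ht.
  assert (Ht1 : t < 1) by (generalize (Rmin_l 1 eps); lra).
  assert (Hte : t < eps) by (generalize (Rmin_r 1 eps); lra).
  assert (Hpow : Rpower t x <= t).
  { rewrite <- (Rpower_1 t Ht0) at 2; unfold Rpower; apply exp_le_compat.
    assert (ln t < 0) by (rewrite <- ln_1; apply ln_increasing; lra); nra. }
  assert (Hexp : exp (- t) < 1) by (rewrite <- exp_0; apply exp_increasing; lra).
  assert (0 < exp (- t)) by apply exp_pos.
  assert (0 < Rpower t x) by apply exp_pos.
  change (Rabs (Rpower t x * exp (- t) - 0) < eps).
  rewrite Rminus_0_r, Rabs_pos_eq by nra; nra.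
Qed.

(** Since ln t / t tends to 0, eventually x ln t <= t / 2. This uses up half of the exponent and
    leaves the bound exp (-t / 2). *)
Lemma Rpower_exp_at_infty (x : R) :
  0 < x ->
  filterlim (fun t => Rpower t x * exp (- t)) (Rbar_locally p_infty) (locally 0).
Proof.
  intros Hx.
  assert (Hhalf : is_lim (fun t => exp (- t / 2)) p_infty 0).
  { apply (is_lim_comp exp (fun t => - t / 2) p_infty 0 m_infty is_lim_exp_m).
    - intros P [M HM]; exists (- 2 * M); intros t Ht; apply HM; lra.
    - exists 0; intros t _; discriminate. }
  apply filterlim_locally; intros eps.
  assert (Hln : Rbar_locally p_infty (fun t => Rabs (ln t / t - 0) < / (2 * x))).
  { assert (He : 0 < / (2 * x)) by (apply Rinv_0_lt_compat; lra).
    exact (proj1 (filterlim_locally _ _) is_lim_div_ln_p (mkposreal _ He)). }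
  generalize (proj1 (filterlim_locally _ _) Hhalf eps); intros [M1 H1].
  destruct Hln as [M2 H2].
  exists (Rmax 0 (Rmax M1 M2)); intros t Ht.
  apply Rmax_Rlt in Ht as [Ht0 Ht]; apply Rmax_Rlt in Ht as [Ht1 Ht2].
  specialize (H1 t Ht1); specialize (H2 t Ht2).
  change (Rabs (exp (- t / 2) - 0) < eps) in H1.
  change (Rabs (Rpower t x * exp (- t) - 0) < eps).
  assert (Hle : Rpower t x * exp (- t) <= exp (- t / 2)).
  { unfold Rpower; rewrite <- exp_plus; apply exp_le_compat.
    rewrite Rminus_0_r in H2; apply Rabs_lt_between in H2.
    assert (ln t <= t * / (2 * x)).
    { replace (ln t) with (t * (ln t / t)) by (field; lra).
      apply Rmult_le_compat_l; lra. }
    assert (x * ln t <= x * (t * / (2 * x))) by (apply Rmult_le_compat_l; lra).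
    replace (x * (t * / (2 * x))) with (t / 2) in * by (field; lra); lra. }
  assert (0 < Rpower t x * exp (- t)) by (apply Rmult_lt_0_compat; apply exp_pos).
  rewrite Rminus_0_r in *; rewrite Rabs_pos_eq in * by lra.
  generalize (Rle_abs (exp (- t / 2))); lra.
Qed.

(** Integration by parts. The derivative [k] of -t^x exp (-t) is the integrand at [x + 1] minus [x]
    times the integrand at [x], and its integral is 0 because both boundary values vanish. *)
Lemma is_Gamma_succ (x l : R) : 1 <= x -> is_Gamma x l -> is_Gamma (x + 1) (x * l).
Proof.
  intros Hx Hl.
  set (K := fun t => - (Rpower t x * exp (- t))).
  set (k := fun t => Rpower t x * exp (- t) - x * (Rpower t (x - 1) * exp (- t))).
  assert (HK : forall t, 0 < t -> is_derive K t (k t)).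
  { intros t Ht; unfold K, k, Rpower; auto_derive; [lra|].
    replace ((x - 1) * ln t) with (x * ln t + - ln t) by ring.
    rewrite exp_plus, (exp_Ropp (ln t)), exp_ln by lra; field; lra. }
  assert (Hk : forall t, 0 < t -> continuous k t).
  { intros t Ht; apply (ex_derive_continuous k).
    unfold k, Rpower; auto_derive; lra. }
  assert (HI : is_RInt_gen (Derive K) (at_right 0) (Rbar_locally p_infty) (0 - 0)).
  { apply is_RInt_gen_Derive.
    - apply filter_prod_pos; intros a b Hab t; simpl.
      rewrite Rmin_left, Rmax_right by lra; intros Ht.
      exists (k t); apply HK; lra.
    - apply filter_prod_pos; intros a b Hab t; simpl.
      rewrite Rmin_left, Rmax_right by lra; intros Ht.
      apply (continuous_ext_loc _ k); [|apply Hk; lra].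
      assert (Ht0 : 0 < t) by lra.
      (* The ball of radius [t] around [t] stays in the half-line where [K] has derivative [k]. *)
      exists (mkposreal t Ht0); intros u Hu.
      apply Rabs_lt_between in Hu; unfold minus, plus, opp in Hu; simpl in Hu.
      symmetry; apply is_derive_unique, HK; lra.
    - replace 0 with (opp 0) at 2 by (unfold opp; simpl; ring).
      apply (filterlim_comp _ _ _ _ (fun y => opp y) _ (locally 0));
        [apply Rpower_exp_at_right_0; lra|apply (filterlim_opp (0 : R))].
    - replace 0 with (opp 0) at 1 by (unfold opp; simpl; ring).
      apply (filterlim_comp _ _ _ _ (fun y => opp y) _ (locally 0));
        [apply Rpower_exp_at_infty; lra|apply (filterlim_opp (0 : R))]. }
  generalize (is_RInt_gen_plus _ _ _ _ HI (is_RInt_gen_scal _ x _ Hl)).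
  unfold is_Gamma.
  replace (x * l) with (plus (0 - 0) (scal x l))
    by (unfold plus, scal; simpl; unfold mult; simpl; ring).
  apply is_RInt_gen_ext, filter_prod_pos; intros a b Hab t; simpl.
  rewrite Rmin_left, Rmax_right by lra; intros Ht.
  rewrite (is_derive_unique K t (k t)) by (apply HK; lra); unfold k.
  replace (x + 1 - 1) with x by ring.
  unfold plus, scal; simpl; unfold mult; simpl; ring.
Qed.

Lemma is_Gamma_1 : is_Gamma 1 1.
Proof.
  unfold is_Gamma.
  assert (HI : is_RInt_gen (Derive (fun t => - exp (- t)))
                 (at_right 0) (Rbar_locally p_infty) (0 - (-1))).
  { apply is_RInt_gen_Derive.
    - apply filter_forall; intros ab t _; auto_derive; easy.
    - apply filter_forall; intros ab t _.
      apply (continuous_ext (fun t => exp (- t))).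
      + intros u; symmetry; apply is_derive_unique; auto_derive; [easy|ring].
      + apply (ex_derive_continuous (fun t => exp (- t))); auto_derive; easy.
    - replace (-1) with (- exp (- 0)) by (rewrite Ropp_0, exp_0; ring).
      apply (continuous_at_right (fun t => - exp (- t))).
      apply (ex_derive_continuous (fun t => - exp (- t))); auto_derive; easy.
    - replace 0 with (opp 0) by (unfold opp; simpl; ring).
      apply (filterlim_comp _ _ _ _ (fun y => opp y) _ (locally 0));
        [|apply (filterlim_opp (0 : R))].
      apply (is_lim_comp exp (fun t => - t) p_infty 0 m_infty is_lim_exp_m).
      + intros P [M HM]; exists (- M); intros t Ht; apply HM; lra.
      + exists 0; intros t _; discriminate. }
  replace (0 - -1) with 1 in HI by ring.
  revert HI; apply is_RInt_gen_ext, filter_forall; intros ab t _.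
  replace (1 - 1) with 0 by ring.
  unfold Rpower; rewrite Rmult_0_l, exp_0, Rmult_1_l.
  apply is_derive_unique; auto_derive; [easy|ring].
Qed.

(** The limit is the supremum. The bound by [l] is kept in the conclusion because it later gives the
    positivity of Gamma at 3/2. *)
Lemma is_lim_increasing_bounded (F : R -> R) (M : R) :
  (forall x y, 0 <= x <= y -> F x <= F y) -> (forall x, 0 <= x -> F x <= M) ->
  exists l : R, is_lim F p_infty l /\ forall x, 0 <= x -> F x <= l.
Proof.
  intros Hinc HM.
  destruct (completeness (fun y => exists x, 0 <= x /\ y = F x)) as [l [Hub Hleast]].
  - exists M; intros y [x [Hx ->]]; apply HM, Hx.
  - exists (F 0), 0; split; [lra|easy].
  - exists l; split; [|intros x Hx; apply Hub; exists x; easy].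
    apply is_lim_spec; intros eps.
    destruct (Classical_Prop.classic (exists x, 0 <= x /\ l - eps < F x))
      as [[x [Hx Hlt]]|Hno].
    + exists x; intros y Hy.
      assert (F x <= F y) by (apply Hinc; lra).
      assert (F y <= l) by (apply Hub; exists y; split; [lra|easy]).
      apply Rabs_lt_between; generalize (cond_pos eps); lra.
    + exfalso; assert (l <= l - eps); [|generalize (cond_pos eps); lra].
      apply Hleast; intros y [x [Hx ->]]; apply Rnot_lt_le; intros Hlt.
      apply Hno; exists x; easy.
Qed.

(** Convergence and positivity suffice, since the value cancels in the quotient defining
    [pochhammer]. At 3/2 the integrand extends continuously to 0, so the integral is improper only
    at infinity. *)
Lemma is_Gamma_3_2 : exists l, 0 < l /\ is_Gamma (3 / 2) l.
Proof.
  set (f := fun t => sqrt t * exp (- t)).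
  assert (Hf : forall t, continuous f t).
  { intros t; apply (continuous_mult (fun t => sqrt t) (fun t => exp (- t))).
    - apply continuous_sqrt.
    - apply (ex_derive_continuous (fun t => exp (- t))); auto_derive; easy. }
  assert (Hex : forall a b, ex_RInt f a b)
    by (intros a b; apply (ex_RInt_continuous f); intros; apply Hf).
  set (F := RInt f 0).
  assert (Hsplit : forall a b, is_RInt f a b (F b - F a)).
  { intros a b; unfold F.
    assert (E : RInt f 0 a + RInt f a b = RInt f 0 b)
      by (apply (RInt_Chasles f 0 a b); auto).
    replace (RInt f 0 b - RInt f 0 a) with (RInt f a b) by lra.
    apply (RInt_correct f), Hex. }
  assert (Hpos : forall t, 0 <= f t).
  { intros t; apply Rmult_le_pos; [apply sqrt_pos|left; apply exp_pos]. }
  assert (Hinc : forall a b, a <= b -> F a <= F b).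
  { intros a b Hab.
    generalize (is_RInt_le (fun _ => 0) f a b _ _ Hab (is_RInt_const a b 0)
                  (Hsplit a b) (fun t _ => Hpos t)).
    unfold scal; simpl; unfold mult; simpl; lra. }
  assert (HF0 : F 0 = 0) by (unfold F; rewrite RInt_point; easy).
  assert (Hbd : forall b, 0 <= b -> F b <= 1).
  { intros b Hb.
    (* By the arithmetic-geometric mean inequality sqrt t <= (t + 1) / 2, and [G] is the
       antiderivative of the resulting majorant; [- G 0 = 1] is the bound. *)
    set (G := fun t => - (t + 2) / 2 * exp (- t)).
    assert (HG : is_RInt (fun t => (t + 1) / 2 * exp (- t)) 0 b (minus (G b) (G 0))).
    { apply (is_RInt_derive G).
      - intros t _; unfold G; auto_derive; [easy|field].
      - intros t _; apply (ex_derive_continuous (fun t => (t + 1) / 2 * exp (- t)));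
          auto_derive; easy. }
    assert (Hle : F b - F 0 <= minus (G b) (G 0)).
    { apply (is_RInt_le f (fun t => (t + 1) / 2 * exp (- t)) 0 b); auto.
      intros t Ht; apply Rmult_le_compat_r; [left; apply exp_pos|].
      generalize (sqrt_sqrt t) (pow2_ge_0 (sqrt t - 1)); nra. }
    unfold G, minus, plus, opp in Hle; simpl in Hle.
    rewrite Ropp_0, exp_0 in Hle.
    assert (0 < exp (- b)) by apply exp_pos; nra. }
  destruct (is_lim_increasing_bounded F 1) as [l [Hl Hle]];
    [intros; apply Hinc; lra|exact Hbd|].
  exists l; split.
  - apply Rlt_le_trans with (F 1); [|apply Hle; lra].
    unfold F; apply RInt_gt_0; [lra| |intros; apply Hf].
    intros t Ht; apply Rmult_lt_0_compat; [apply sqrt_lt_R0; lra|apply exp_pos].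
  - unfold is_Gamma.
    apply is_RInt_gen_ext with f.
    { apply filter_prod_pos; intros a b Hab t; simpl.
      rewrite Rmin_left, Rmax_right by lra; intros Ht; unfold f.
      replace (3 / 2 - 1) with (/ 2) by field.
      rewrite Rpower_sqrt by lra; easy. }
    assert (Hc : filterlim F (at_right 0) (locally 0)).
    { rewrite <- HF0 at 2; apply continuous_at_right.
      apply (ex_derive_continuous F); exists (f 0).
      apply (is_derive_RInt f F 0); [|apply Hf].
      apply filter_forall; intros x; apply (RInt_correct f), Hex. }
    apply filterlimi_locally; intros eps.
    assert (He2 : 0 < eps / 2) by (generalize (cond_pos eps); lra).
    apply (Filter_prod _ _ _ (fun a => ball 0 (eps / 2) (F a))
             (fun b => ball l (eps / 2) (F b))).
    + exact (proj1 (filterlim_locally _ _) Hc (mkposreal _ He2)).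
    + exact (proj1 (filterlim_locally _ _) Hl (mkposreal _ He2)).
    + intros a b Ha Hb; exists (F b - F a); split; [apply Hsplit|].
      change (Rabs (F a - 0) < eps / 2) in Ha.
      change (Rabs (F b - l) < eps / 2) in Hb.
      change (Rabs (F b - F a - l) < eps).
      apply Rabs_lt_between in Ha; apply Rabs_lt_between in Hb.
      apply Rabs_lt_between; lra.
Qed.

Lemma is_Gamma_add_INR (x l : R) (n : nat) :
  1 <= x -> 0 < l -> is_Gamma x l -> exists m, 0 < m /\ is_Gamma (x + INR n) m.
Proof.
  intros Hx Hl H; induction n as [|n [m [Hm IH]]].
  - exists l; rewrite Rplus_0_r; easy.
  - generalize (pos_INR n); intros Hn.
    exists ((x + INR n) * m); split; [apply Rmult_lt_0_compat; lra|].
    rewrite S_INR, <- Rplus_assoc; apply is_Gamma_succ; [lra|exact IH].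
Qed.

(** * Rising factorials *)

Lemma pochhammer_0 (x l : R) : 0 < l -> is_Gamma x l -> pochhammer x 0 = 1.
Proof.
  intros Hl H; unfold pochhammer; rewrite Rplus_0_r, (is_Gamma_unique _ _ H).
  field; lra.
Qed.

Lemma pochhammer_S (x l : R) (n : nat) :
  1 <= x -> 0 < l -> is_Gamma x l ->
  pochhammer x (S n) = pochhammer x n * (x + INR n).
Proof.
  intros Hx Hl H; unfold pochhammer.
  destruct (is_Gamma_add_INR x l n Hx Hl H) as [m [Hm Hxm]].
  generalize (pos_INR n); intros Hn.
  assert (Hs : is_Gamma (x + INR (S n)) ((x + INR n) * m)).
  { rewrite S_INR, <- Rplus_assoc; apply is_Gamma_succ; [lra|exact Hxm]. }
  rewrite (is_Gamma_unique _ _ H), (is_Gamma_unique _ _ Hxm),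
    (is_Gamma_unique _ _ Hs).
  field; lra.
Qed.

Lemma pochhammer_1 (n : nat) : pochhammer 1 n = INR (fact n).
Proof.
  induction n as [|n IH].
  - rewrite (pochhammer_0 1 1 Rlt_0_1 is_Gamma_1); easy.
  - rewrite (pochhammer_S 1 1 n (Rle_refl 1) Rlt_0_1 is_Gamma_1), IH.
    rewrite fact_simpl, mult_INR, S_INR; ring.
Qed.

(** * Wallis numbers and the reduction of the hypergeometric term *)

Definition wallis (n : nat) : R :=
  4 ^ n / ((2 * INR n + 1) * Binomial.C (2 * n) n).

Lemma central_binomial_pos (n : nat) : 0 < Binomial.C (2 * n) n.
Proof.
  unfold Binomial.C; apply Rdiv_lt_0_compat; [apply INR_fact_lt_0|].
  apply Rmult_lt_0_compat; apply INR_fact_lt_0.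
Qed.

Lemma wallis_0 : wallis 0 = 1.
Proof. unfold wallis, Binomial.C; simpl; field. Qed.

Lemma wallis_S (n : nat) :
  wallis (S n) = wallis n * ((2 * INR n + 2) / (2 * INR n + 3)).
Proof.
  unfold wallis, Binomial.C.
  replace (2 * S n - S n)%nat with (S n) by lia.
  replace (2 * n - n)%nat with n by lia.
  replace (2 * S n)%nat with (S (S (2 * n))) by lia.
  rewrite !fact_simpl, !mult_INR, !S_INR, mult_INR, <- tech_pow_Rmult.
  change (INR 2) with 2.
  generalize (pos_INR n) (INR_fact_lt_0 n) (INR_fact_lt_0 (2 * n)); intros.
  field; repeat split; nra.
Qed.

Lemma wallis_pos (n : nat) : 0 < wallis n.
Proof.
  generalize (pos_INR n) (central_binomial_pos n); intros.
  apply Rdiv_lt_0_compat; [apply pow_lt; lra|apply Rmult_lt_0_compat; lra].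
Qed.

Lemma binom_term_wallis (n : nat) :
  binom_term n = wallis n ^ 2 / (2 * INR n + 3) ^ 3.
Proof.
  generalize (pos_INR n) (central_binomial_pos n); intros.
  unfold binom_term, wallis.
  replace 16 with (4 * 4) by ring; rewrite Rpow_mult_distr.
  field; repeat split; lra.
Qed.

Lemma pochhammer_3_2_pos (n : nat) : 0 < pochhammer (3 / 2) n.
Proof.
  destruct is_Gamma_3_2 as [l [Hl H]].
  induction n as [|n IH].
  - rewrite (pochhammer_0 _ l); auto; lra.
  - rewrite (pochhammer_S _ l); auto; [|lra].
    generalize (pos_INR n); intros; apply Rmult_lt_0_compat; lra.
Qed.

(** Both sides gain the factor n + 1 at each step, as (2n+2)/(2n+3) * (n + 3/2) = n + 1. *)
Lemma pochhammer_3_2_wallis (n : nat) :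
  INR (fact n) = wallis n * pochhammer (3 / 2) n.
Proof.
  destruct is_Gamma_3_2 as [l [Hl H]].
  induction n as [|n IH].
  - rewrite (pochhammer_0 _ l), wallis_0; auto; simpl; lra.
  - rewrite (pochhammer_S _ l), wallis_S, fact_simpl, mult_INR, IH, S_INR; auto;
      [|lra].
    generalize (pos_INR n); intros; field; lra.
Qed.

(** The quotient of the two products telescopes to (n + 3/2) / (3/2). *)
Lemma pochhammer_5_2 (n : nat) :
  pochhammer (5 / 2) n = pochhammer (3 / 2) n * ((2 * INR n + 3) / 3).
Proof.
  destruct is_Gamma_3_2 as [l [Hl H]].
  assert (H' : is_Gamma (5 / 2) (3 / 2 * l)).
  { replace (5 / 2) with (3 / 2 + 1) by field; apply is_Gamma_succ; [lra|easy]. }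
  induction n as [|n IH].
  - rewrite (pochhammer_0 (3 / 2) l), (pochhammer_0 _ (3 / 2 * l)); auto; simpl; lra.
  - rewrite (pochhammer_S (3 / 2) l), (pochhammer_S _ (3 / 2 * l)), IH, S_INR; auto;
      try field; lra.
Qed.

(** One of the three upper factorials cancels n!; the other two, against two factors (3/2)_n, give
    [wallis n ^ 2]. The shift from 3/2 to 5/2 in three lower parameters gives 27 / (2n+3)^3. *)
Lemma hyp4F3_term_binom_term (n : nat) :
  hyp4F3_term 1 1 1 (3/2) (5/2) (5/2) (5/2) 1 n = 27 * binom_term n.
Proof.
  unfold hyp4F3_term.
  rewrite binom_term_wallis, pow1, pochhammer_1, pochhammer_5_2,
    (pochhammer_3_2_wallis n).
  generalize (pos_INR n) (pochhammer_3_2_pos n) (wallis_pos n); intros.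
  field; lra.
Qed.

(** * Trigonometric inequalities on the quarter period *)

Lemma sum_n_S (a : nat -> R) (n : nat) : sum_n a (S n) = sum_n a n + a (S n).
Proof. exact (sum_Sn a n). Qed.

Lemma is_RInt_antiderivative (F f : R -> R) (a b l : R) :
  a <= b -> F b - F a = l -> (forall x, a <= x <= b -> is_derive F x (f x)) ->
  (forall x, a <= x <= b -> ex_derive f x) -> is_RInt f a b l.
Proof.
  intros Hab <- HF Hf; apply (is_RInt_derive F f); rewrite Rmin_left, Rmax_right by lra.
  - exact HF.
  - intros x Hx; apply (ex_derive_continuous f), Hf, Hx.
Qed.

Lemma sin_cos_pos (s : R) : 0 <= s <= PI / 2 -> 0 <= sin s <= 1 /\ 0 <= cos s <= 1.
Proof.
  intros Hs; generalize PI_RGT_0 (SIN_bound s) (COS_bound s); intros.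
  assert (0 <= sin s) by (apply sin_ge_0; lra).
  assert (0 <= cos s) by (apply cos_ge_0; lra).
  lra.
Qed.

Lemma sin_ge_mul_cos (s : R) : 0 <= s <= PI / 2 -> s * cos s <= sin s.
Proof.
  intros Hs.
  assert (HI : is_RInt (fun t => t * sin t) 0 s
(sin s - s * cos s)).
  { apply (is_RInt_antiderivative (fun t => sin t - t * cos t));
      [lra|rewrite sin_0; ring| |].
    - intros t _; auto_derive; [easy|ring].
    - intros t _; auto_derive; easy. }
  assert (Hle := is_RInt_le _ _ 0 s _ _ (proj1 Hs) (is_RInt_const 0 s 0) HI).
  unfold scal in Hle; simpl in Hle; unfold mult in Hle; simpl in Hle.
  enough (forall t, 0 < t < s -> 0 <= t * sin t) by (specialize (Hle H); lra).
  intros t Ht; apply Rmult_le_pos; [lra|apply sin_cos_pos; lra].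
Qed.

(** Both values lie in [0, 1], so 1 = sin^2 + cos^2 <= sin + cos. *)
Lemma one_sub_cos_le_sin (s : R) : 0 <= s <= PI / 2 -> 1 - cos s <= sin s.
Proof.
  intros Hs; generalize (sin_cos_pos s Hs) (sin2_cos2 s); unfold Rsqr; nra.
Qed.

(** Write s = s cos s + s (1 - cos s) <= sin s + s sin s, and use s <= PI / 2 <= 2. *)
Lemma le_3_sin (s : R) : 0 <= s <= PI / 2 -> s <= 3 * sin s.
Proof.
  intros Hs; generalize (sin_ge_mul_cos s Hs) (one_sub_cos_le_sin s Hs)
    (sin_cos_pos s Hs) PI_4; intros; nra.
Qed.

Lemma compl_le_3_cos (s : R) : 0 <= s <= PI / 2 -> PI / 2 - s <= 3 * cos s.
Proof.
  intros Hs; rewrite <- sin_shift; apply le_3_sin; lra.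
Qed.

(** * Wallis integrals and the arcsine expansion *)

Lemma is_derive_cos_mul_sin_pow (m : nat) (c s : R) :
  is_derive (fun s => cos s * (c * sin s ^ (m + 1))) s
    (c * ((INR m + 1) * sin s ^ m - (INR m + 2) * sin s ^ (m + 2))).
Proof.
  auto_derive; [easy|].
  rewrite !pow_add, plus_INR; replace (Init.Nat.pred (m + 1)) with m by lia.
  simpl (sin s ^ 1); simpl (sin s ^ 2); simpl (INR 1).
  assert (Hc : cos s * cos s = 1 - sin s * sin s)
    by (generalize (sin2_cos2 s); unfold Rsqr; lra).
  transitivity (c * sin s ^ m * ((INR m + 1) * (cos s * cos s) - sin s * sin s));
    [ring|rewrite Hc; ring].
Qed.

(** The antiderivative vanishes at both ends. With the sign -1, adding m + 1 times the integral of
    sin^m leaves only the power m + 2. *)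
Lemma is_RInt_sin_pow_rec (m : nat) :
  is_RInt (fun s => -1 * ((INR m + 1) * sin s ^ m - (INR m + 2) * sin s ^ (m + 2)))
    0 (PI / 2) 0.
Proof.
  generalize PI_RGT_0; intros HPI.
  apply (is_RInt_antiderivative (fun s => cos s * (-1 * sin s ^ (m + 1)))); [lra| | |].
  - rewrite sin_0, cos_PI2, pow_i by lia; ring.
  - intros s _; apply is_derive_cos_mul_sin_pow.
  - intros s _; auto_derive; easy.
Qed.

Lemma is_RInt_wallis (n : nat) :
  is_RInt (fun s => sin s ^ (2 * n + 1)) 0 (PI / 2) (wallis n).
Proof.
  generalize PI_RGT_0; intros HPI.
  induction n as [|n IH].
  - rewrite wallis_0.
    apply (is_RInt_antiderivative (fun s => - cos s)); [lra| | |].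
    + rewrite cos_PI2, cos_0; ring.
    + intros s _; auto_derive; [easy|simpl; ring].
    + intros s _; auto_derive; easy.
  - generalize (pos_INR n); intros Hn.
    assert (H := is_RInt_scal _ _ _ (/ (2 * INR n + 3)) _
              (is_RInt_plus _ _ _ _ _ _ (is_RInt_sin_pow_rec (2 * n + 1))
                 (is_RInt_scal _ _ _ (2 * INR n + 2) _ IH))).
    replace (wallis (S n)) with
      (scal (/ (2 * INR n + 3)) (plus 0 (scal (2 * INR n + 2) (wallis n)))).
    2: { rewrite wallis_S; unfold plus, scal; simpl; unfold mult; simpl; field; lra. }
    revert H; apply is_RInt_ext; intros s _.
    replace (2 * S n + 1)%nat with (2 * n + 1 + 2)%nat by lia.
    rewrite plus_INR, mult_INR; change (INR 2) with 2; change (INR 1) with 1.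
    unfold plus, scal; simpl; unfold mult; simpl; field; lra.
Qed.

(** With u_n = (2n+1) w_n sin^(2n) s, the relation (2n+2) w_n = (2n+3) w_(n+1) makes the derivative
    of the n-th term u_n - u_(n+1). The sum telescopes from u_0 = 1. *)
Lemma is_derive_cos_mul_sum (N : nat) (s : R) :
  is_derive (fun s => cos s * sum_n (fun n => wallis n * sin s ^ (2 * n + 1)) N) s
    (1 - (2 * INR N + 3) * wallis (S N) * sin s ^ (2 * N + 2)).
Proof.
  assert (Hterm : forall n, is_derive (fun s => cos s * (wallis n * sin s ^ (2 * n + 1))) s
     ((2 * INR n + 1) * wallis n * sin s ^ (2 * n)
      - (2 * INR n + 3) * wallis (S n) * sin s ^ (2 * n + 2))).
  { intros n; generalize (pos_INR n); intros Hn.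
    replace (_ - _) with (wallis n * ((INR (2 * n) + 1) * sin s ^ (2 * n)
                            - (INR (2 * n) + 2) * sin s ^ (2 * n + 2)));
      [apply is_derive_cos_mul_sin_pow|].
    rewrite wallis_S, mult_INR; change (INR 2) with 2; field; lra. }
  induction N as [|N IH].
  - apply (is_derive_ext (fun s => cos s * (wallis 0 * sin s ^ (2 * 0 + 1)))).
    + intros t; rewrite sum_O; easy.
    + generalize (Hterm 0%nat); rewrite wallis_0; simpl (INR 0).
      replace ((2 * 0 + 1) * 1 * sin s ^ (2 * 0)) with 1 by (simpl; ring); easy.
  - apply (is_derive_ext
      (fun s => cos s * sum_n (fun n => wallis n * sin s ^ (2 * n + 1)) N
         + cos s * (wallis (S N) * sin s ^ (2 * S N + 1)))).
    + intros t; rewrite sum_n_S; symmetry; apply Rmult_plus_distr_l.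
    + generalize (is_derive_plus _ _ _ _ _ IH (Hterm (S N))).
      replace (2 * N + 2)%nat with (2 * S N)%nat by lia.
      rewrite S_INR at 1; unfold plus; simpl.
      intros H; match goal with |- is_derive _ _ ?v => match type of H with
        is_derive _ _ ?u => replace v with u by (rewrite ?S_INR; ring) end end; exact H.
Qed.

(* [s] minus the truncation of its expansion coming from
   [arcsin x / sqrt (1 - x ^ 2) = sum wallis n * x ^ (2 * n + 1)] at [x = sin s]. *)
Definition arcsin_remainder (N : nat) (s : R) : R :=
  s - cos s * sum_n (fun n => wallis n * sin s ^ (2 * n + 1)) N.

(** After the telescoping, a single power of sine survives in the derivative, and the remainder
    vanishes at 0. *)
Lemma is_RInt_arcsin_remainder (N : nat) (s : R) :
  0 <= s ->
  is_RInt (fun t => (2 * INR N + 3) * wallis (S N) * sin t ^ (2 * N + 2)) 0 s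
    (arcsin_remainder N s).
Proof.
  intros Hs.
  apply (is_RInt_antiderivative (arcsin_remainder N)); [exact Hs| | |].
  - unfold arcsin_remainder.
    replace (sum_n (fun n => wallis n * sin 0 ^ (2 * n + 1)) N) with 0; [ring|].
    clear; induction N as [|N IH].
    + rewrite sum_O, sin_0; simpl; ring.
    + rewrite sum_n_S, <- IH, sin_0, pow_i by lia; ring.
  - intros t _.
    replace (_ * _) with (1 - (1 - (2 * INR N + 3) * wallis (S N) * sin t ^ (2 * N + 2)))
      by ring.
    exact (is_derive_minus (fun t => t) _ t _ _ (is_derive_id t)
             (is_derive_cos_mul_sum N t)).
  - intros t _; auto_derive; easy.
Qed.

Lemma arcsin_remainder_coeff_pos (N : nat) : 0 < (2 * INR N + 3) * wallis (S N).
Proof.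
  generalize (pos_INR N) (wallis_pos (S N)); intros; apply Rmult_lt_0_compat; lra.
Qed.

(** The integrand is nonnegative and increasing, so the integral is at most [s] times its value at
    the right end. *)
Lemma arcsin_remainder_bounds (N : nat) (s : R) :
  0 <= s <= PI / 2 ->
  0 <= arcsin_remainder N s
    <= (2 * INR N + 3) * wallis (S N) * s * sin s ^ (2 * N + 2).
Proof.
  intros Hs; generalize (arcsin_remainder_coeff_pos N); intros Hc.
  assert (HI := is_RInt_arcsin_remainder N s (proj1 Hs)).
  split.
  - assert (H := is_RInt_le _ _ 0 s _ _ (proj1 Hs) (is_RInt_const 0 s 0) HI).
    unfold scal in H; simpl in H; unfold mult in H; simpl in H.
    rewrite Rmult_0_r in H; apply H; intros t Ht.
    apply Rmult_le_pos; [lra|apply pow_le, sin_cos_pos; lra].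
  - assert (H := is_RInt_le _ _ 0 s _ _ (proj1 Hs) HI
      (is_RInt_const 0 s ((2 * INR N + 3) * wallis (S N) * sin s ^ (2 * N + 2)))).
    unfold scal in H; simpl in H; unfold mult in H; simpl in H.
    eapply Rle_trans; [apply H|right; simpl; ring].
    intros t Ht; apply Rmult_le_compat_l; [lra|].
    apply pow_incr; split; [apply sin_cos_pos; lra|apply sin_incr_1; lra].
Qed.

(** * Asymptotics of the Wallis numbers *)

Lemma sin_pow_decr (m : nat) (s : R) :
  0 <= s <= PI / 2 -> sin s ^ (S m) <= sin s ^ m.
Proof.
  intros Hs; destruct (sin_cos_pos s Hs) as [Hsin _].
  generalize (pow_le (sin s) m (proj1 Hsin)); simpl; nra.
Qed.

(** At PI / 2 the cosine kills the truncated sum, so the remainder integral equals PI / 2. Comparing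
    its power 2N+2 with the powers 2N+3 and 2N+1 puts PI / 2 between (2N+3) w_(N+1) times w_(N+1)
    and times w_N. *)
Lemma wallis_sq_bounds (N : nat) :
  PI / 2 * ((2 * INR N + 2) / (2 * INR N + 3))
    <= (2 * INR N + 3) * wallis (S N) ^ 2 <= PI / 2.
Proof.
  generalize PI_RGT_0 (pos_INR N) (wallis_pos (S N)) (wallis_pos N)
    (arcsin_remainder_coeff_pos N); intros HPI HN Hw1 Hw Hc.
  assert (HI := is_RInt_arcsin_remainder N (PI / 2) ltac:(lra)).
  unfold arcsin_remainder in HI; rewrite cos_PI2, Rmult_0_l, Rminus_0_r in HI.
  assert (Hlow := is_RInt_scal _ _ _ ((2 * INR N + 3) * wallis (S N)) _
                    (is_RInt_wallis (S N))).
  assert (Hup := is_RInt_scal _ _ _ ((2 * INR N + 3) * wallis (S N)) _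
                    (is_RInt_wallis N)).
  set (c := (2 * INR N + 3) * wallis (S N)) in *.
  assert (H1' : c * wallis (S N) <= PI / 2).
  { apply (is_RInt_le _ _ 0 (PI / 2) _ _ ltac:(lra) Hlow HI); intros t Ht.
    change (c * sin t ^ (2 * S N + 1) <= c * sin t ^ (2 * N + 2)).
    apply Rmult_le_compat_l; [lra|].
    replace (2 * S N + 1)%nat with (S (2 * N + 2)) by lia.
    apply sin_pow_decr; lra. }
  assert (H2' : PI / 2 <= c * wallis N).
  { apply (is_RInt_le _ _ 0 (PI / 2) _ _ ltac:(lra) HI Hup); intros t Ht.
    change (c * sin t ^ (2 * N + 2) <= c * sin t ^ (2 * N + 1)).
    apply Rmult_le_compat_l; [lra|].
    replace (2 * N + 2)%nat with (S (2 * N + 1)) by lia.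
    apply sin_pow_decr; lra. }
  unfold c in *; clear c.
  split; [|lra].
  assert (E : wallis (S N) = wallis N * ((2 * INR N + 2) / (2 * INR N + 3)))
    by apply wallis_S.
  assert (0 < (2 * INR N + 2) / (2 * INR N + 3)) by (apply Rdiv_lt_0_compat; lra).
  apply Rle_trans with ((2 * INR N + 3) * wallis (S N) * wallis N
                         * ((2 * INR N + 2) / (2 * INR N + 3))).
  - apply Rmult_le_compat_r; lra.
  - right; rewrite E; ring.
Qed.

Lemma is_lim_seq_inv_INR (a b : R) :
  0 < a -> 0 < b -> is_lim_seq (fun n => / (a * INR n + b)) 0.
Proof.
  intros Ha Hb.
  apply (is_lim_seq_inv (fun n => a * INR n + b) p_infty); [|discriminate].
  apply (is_lim_seq_plus (fun n => a * INR n) (fun _ => b) p_infty b).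
  - replace p_infty with (Rbar_mult a p_infty).
    + apply is_lim_seq_scal_l, is_lim_seq_INR.
    + simpl; destruct Rle_dec; [destruct Rle_lt_or_eq_dec|]; [easy|lra|lra].
  - apply is_lim_seq_const.
  - easy.
Qed.

Lemma is_lim_wallis_sq :
  is_lim_seq (fun n => (2 * INR n + 1) * wallis n ^ 2) (PI / 2).
Proof.
  apply is_lim_seq_incr_1.
  apply (is_lim_seq_ext (fun N => (2 * INR N + 3) * wallis (S N) ^ 2)).
  { intros n; rewrite S_INR; ring. }
  apply (is_lim_seq_le_le (fun N => PI / 2 - PI / 2 * / (2 * INR N + 3)) _
           (fun _ => PI / 2)).
  - intros N; split; [|apply wallis_sq_bounds].
    eapply Rle_trans; [|apply wallis_sq_bounds].
    generalize (pos_INR N); intros; right; field; lra.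
  - replace (Finite (PI / 2)) with (Rbar_minus (PI / 2) (PI / 2 * 0))
      by (simpl; apply f_equal; ring).
    apply is_lim_seq_minus'; [apply is_lim_seq_const|].
    apply (is_lim_seq_scal_l _ (PI / 2) 0), is_lim_seq_inv_INR; lra.
  - apply is_lim_seq_const.
Qed.

Lemma is_lim_wallis_sq_0 : is_lim_seq (fun n => wallis n ^ 2) 0.
Proof.
  apply (is_lim_seq_ext
    (fun n => (2 * INR n + 1) * wallis n ^ 2 * / (2 * INR n + 1))).
  { intros n; generalize (pos_INR n); intros; field; lra. }
  replace 0 with (PI / 2 * 0) by ring.
  apply is_lim_seq_mult'; [apply is_lim_wallis_sq|apply is_lim_seq_inv_INR; lra].
Qed.

Lemma is_lim_wallis : is_lim_seq wallis 0.
Proof.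
  apply (is_lim_seq_ext (fun n => sqrt (wallis n ^ 2))).
  { intros n; apply sqrt_pow2; left; apply wallis_pos. }
  rewrite <- sqrt_0.
  apply (is_lim_seq_continuous sqrt); [|apply is_lim_wallis_sq_0].
  apply continuity_pt_filterlim, continuous_sqrt.
Qed.

(* Truncation of the expansion of [s / sin s]. *)
Definition arcsin_series (N : nat) (s : R) : R :=
  cos s * sum_n (fun n => wallis n * sin s ^ (2 * n)) N.

Lemma sin_mul_arcsin_series (N : nat) (s : R) :
  sin s * arcsin_series N s = s - arcsin_remainder N s.
Proof.
  unfold arcsin_series, arcsin_remainder.
  replace (sum_n (fun n => wallis n * sin s ^ (2 * n + 1)) N)
    with (sin s * sum_n (fun n => wallis n * sin s ^ (2 * n)) N); [ring|].
  induction N as [|N IH].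
  - rewrite !sum_O; simpl; ring.
  - rewrite !sum_n_S, <- IH, pow_add, pow_1; ring.
Qed.

(** * Termwise integration of the two truncations *)

Lemma is_RInt_sum_n (f : nat -> R -> R) (l : nat -> R) (a b : R) (N : nat) :
  (forall n, is_RInt (f n) a b (l n)) ->
  is_RInt (fun s => sum_n (fun n => f n s) N) a b (sum_n l N).
Proof.
  intros H; induction N as [|N IH].
  - rewrite sum_O; apply (is_RInt_ext (f 0%nat)); [|apply H].
    intros s _; rewrite sum_O; easy.
  - rewrite sum_Sn.
    apply (is_RInt_ext (fun s => plus (sum_n (fun n => f n s) N) (f (S N) s))).
    + intros s _; rewrite sum_Sn; easy.
    + exact (is_RInt_plus _ _ _ _ _ _ IH (H (S N))).
Qed.

(** Each term is integrated by parts: (PI / 2 - s) sin^(2n+1) s vanishes at both ends, which leaves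
    a multiple of the Wallis integral. *)
Lemma is_RInt_arcsin_series (N : nat) :
  is_RInt (fun s => (PI / 2 - s) * arcsin_series N s) 0 (PI / 2)
    (sum_n (fun n => wallis n ^ 2 / (2 * INR n + 1)) N).
Proof.
  generalize PI_RGT_0; intros HPI.
  apply (is_RInt_ext (fun s => sum_n
    (fun n => (PI / 2 - s) * (cos s * (wallis n * sin s ^ (2 * n)))) N)).
  { intros s _; unfold arcsin_series.
    rewrite <- (sum_n_mult_l (K := R_Ring) (cos s)).
    rewrite <- (sum_n_mult_l (K := R_Ring) (PI / 2 - s)); easy. }
  apply is_RInt_sum_n; intros n.
  generalize (pos_INR n); intros Hn.
  set (c := wallis n / (2 * INR n + 1)).
  assert (HF : is_RInt
    (fun s => c * ((PI / 2 - s) * cos s * (2 * INR n + 1) * sin s ^ (2 * n)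
       - sin s ^ (2 * n + 1))) 0 (PI / 2) 0).
  { apply (is_RInt_antiderivative (fun s => c * ((PI / 2 - s) * sin s ^ (2 * n + 1))));
      [lra| | |].
    - rewrite sin_0, (pow_i (2 * n + 1)) by lia; ring.
    - intros s _.
      replace (2 * INR n + 1) with (INR (2 * n + 1))
        by (rewrite plus_INR, mult_INR; simpl; ring).
      generalize (2 * n)%nat; intros q; auto_derive; [easy|].
      replace (Init.Nat.pred (q + 1)) with q by lia; ring.
    - intros s _; auto_derive; easy. }
  assert (H := is_RInt_plus _ _ _ _ _ _ HF (is_RInt_scal _ _ _ c _ (is_RInt_wallis n))).
  replace (wallis n ^ 2 / (2 * INR n + 1)) with (plus 0 (scal c (wallis n))).
  2: { unfold plus, scal; simpl; unfold mult, c; simpl; field; lra. }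
  revert H; apply is_RInt_ext; intros s _.
  change (c * ((PI / 2 - s) * cos s * (2 * INR n + 1) * sin s ^ (2 * n)
            - sin s ^ (2 * n + 1)) + c * sin s ^ (2 * n + 1)
          = (PI / 2 - s) * (cos s * (wallis n * sin s ^ (2 * n)))).
  unfold c; field; lra.
Qed.

(* Truncation of the divergent Fourier series of [1 / sin s]. *)
Definition sine_series (N : nat) (s : R) : R :=
  2 * sum_n (fun k => sin ((2 * INR k + 1) * s)) N.

(** By [Hstep] at x = 2ks each product is a difference of consecutive cosines, and the sum
    telescopes. *)
Lemma sin_mul_sine_series (N : nat) (s : R) :
  sin s * sine_series N s = 1 - cos ((2 * INR N + 2) * s).
Proof.
  assert (Hstep : forall x, 2 * (sin s * sin (x + s)) = cos x - cos (x + 2 * s)).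
  { intros x; replace x with ((x + s) - s) at 2 by ring.
    replace (x + 2 * s) with ((x + s) + s) by ring.
    rewrite cos_minus, (cos_plus (x + s)); ring. }
  unfold sine_series; induction N as [|N IH].
  - rewrite sum_O; generalize (Hstep 0); rewrite cos_0; simpl (INR 0).
    replace ((2 * 0 + 1) * s) with (0 + s) by ring.
    replace ((2 * 0 + 2) * s) with (0 + 2 * s) by ring; lra.
  - rewrite sum_n_S.
    generalize (Hstep ((2 * INR N + 2) * s)); rewrite S_INR.
    replace ((2 * (INR N + 1) + 1) * s) with ((2 * INR N + 2) * s + s) by ring.
    replace ((2 * (INR N + 1) + 2) * s) with ((2 * INR N + 2) * s + 2 * s) by ring.
    lra.
Qed.

Lemma sin_cos_odd_half_PI (k : nat) :
  sin ((2 * INR k + 1) * (PI / 2)) = (-1) ^ k /\ cos ((2 * INR k + 1) * (PI / 2)) = 0.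
Proof.
  induction k as [|k [IHs IHc]].
  - simpl; replace ((2 * 0 + 1) * (PI / 2)) with (PI / 2) by field.
    rewrite sin_PI2, cos_PI2; easy.
  - rewrite S_INR.
    replace ((2 * (INR k + 1) + 1) * (PI / 2)) with ((2 * INR k + 1) * (PI / 2) + PI)
      by field.
    rewrite neg_sin, neg_cos, IHs, IHc; simpl; split; ring.
Qed.

Lemma is_RInt_sine_series (N : nat) :
  is_RInt (fun s => (PI / 2 - s) * (s * sine_series N s)) 0 (PI / 2)
    (sum_n (fun k => 4 * / (2 * INR k + 1) ^ 3
                     - PI * ((-1) ^ k / (2 * INR k + 1) ^ 2)) N).
Proof.
  generalize PI_RGT_0; intros HPI.
  apply (is_RInt_ext (fun s => sum_n
    (fun k => 2 * (PI / 2 - s) * s * sin ((2 * INR k + 1) * s)) N)).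
  { intros s _; unfold sine_series.
    set (f := fun k => sin ((2 * INR k + 1) * s)).
    rewrite (sum_n_mult_l (K := R_Ring) (2 * (PI / 2 - s) * s) f).
    change (2 * (PI / 2 - s) * s * sum_n f N = (PI / 2 - s) * (s * (2 * sum_n f N))).
    ring. }
  apply is_RInt_sum_n; intros k.
  generalize (pos_INR k) (sin_cos_odd_half_PI k); intros Hk [Hsin Hcos].
  set (m := 2 * INR k + 1) in *.
  assert (Hm : 0 < m) by (unfold m; lra).
  (* This is the result of integrating by parts twice. The sine term at PI / 2 gives -PI (-1)^k /
     m^2, and the last cosine term at 0 gives 4 / m^3. *)
  apply (is_RInt_antiderivative (fun s =>
    - 2 * ((PI / 2 - s) * s) * cos (m * s) / m
    + 2 * (PI / 2 - 2 * s) * sin (m * s) / m ^ 2 - 4 * cos (m * s) / m ^ 3));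
    [lra| | |].
  - rewrite Hsin, Hcos, (Rmult_0_r m), sin_0, cos_0; field; lra.
  - intros s _; auto_derive; [easy|field; lra].
  - intros s _; auto_derive; easy.
Qed.

(** * The difference of the truncated kernels has vanishing integral in the limit *)

Definition kernel_difference (N : nat) (s : R) : R :=
  (PI / 2 - s) * (s * sine_series N s) - (PI / 2 - s) * arcsin_series N s.

(** The main part s / sin s is common to both truncations and cancels, leaving the arcsine remainder
    and an oscillating term. *)
Lemma kernel_difference_eq (N : nat) (s : R) :
  sin s <> 0 ->
  kernel_difference N s =
    (PI / 2 - s) * (arcsin_remainder N s - s * cos ((2 * INR N + 2) * s)) / sin s.
Proof.
  intros Hs; unfold kernel_difference.
  assert (E1 := sin_mul_sine_series N s); assert (E2 := sin_mul_arcsin_series N s).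
  replace (cos ((2 * INR N + 2) * s)) with (1 - sin s * sine_series N s) by lra.
  replace (arcsin_remainder N s) with (s - sin s * arcsin_series N s) by lra.
  field; exact Hs.
Qed.

Lemma sum_n_nonneg (a : nat -> R) (N : nat) : (forall n, 0 <= a n) -> 0 <= sum_n a N.
Proof.
  intros Ha; induction N as [|N IH].
  - rewrite sum_O; apply Ha.
  - rewrite sum_n_S; generalize (Ha (S N)); lra.
Qed.

(** A bound uniform in [N], for use near 0. The constant is 2 * 2 * 3, from PI / 2 - s <= 2,
    [Rabs y <= 2 * s] and s / sin s <= 3. *)
Lemma kernel_difference_le_12 (N : nat) (s : R) :
  0 < s <= PI / 2 -> -12 <= kernel_difference N s <= 12.
Proof.
  intros Hs.
  assert (Hsin : 0 < sin s) by (apply sin_gt_0; generalize PI_RGT_0; lra).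
  rewrite kernel_difference_eq by lra.
  set (y := arcsin_remainder N s - s * cos ((2 * INR N + 2) * s)).
  assert (Hy : - (2 * s) <= y <= 2 * s).
  { generalize (arcsin_remainder_bounds N s ltac:(lra))
      (COS_bound ((2 * INR N + 2) * s)); intros Hrem Hcos.
    assert (Hle : arcsin_remainder N s <= s).
    { assert (0 <= cos s * sum_n (fun n => wallis n * sin s ^ (2 * n + 1)) N).
      { apply Rmult_le_pos; [apply sin_cos_pos; lra|apply sum_n_nonneg; intros n].
        apply Rmult_le_pos; [left; apply wallis_pos|apply pow_le; lra]. }
      unfold arcsin_remainder; lra. }
    unfold y; nra. }
  generalize (le_3_sin s ltac:(lra)) PI_4; intros H3 HPI.
  assert (Hq : -6 <= y / sin s <= 6).
  { split; [apply Rle_div_r|apply Rle_div_l]; lra. }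
  unfold Rdiv in *; rewrite Rmult_assoc; nra.
Qed.

(** The integrated term when the oscillating cosine is integrated by parts; its derivative is that
    oscillating part plus an error of order 1/N. *)
Definition boundary_term (N : nat) (s : R) : R :=
  (PI / 2 - s) * s / sin s * (sin ((2 * INR N + 2) * s) / (2 * INR N + 2)).

Definition boundary_term_deriv (N : nat) (s : R) : R :=
  (PI / 2 - s) * s / sin s * cos ((2 * INR N + 2) * s)
  + ((PI / 2 - s) * (sin s - s * cos s) - s * sin s) / sin s ^ 2
    * (sin ((2 * INR N + 2) * s) / (2 * INR N + 2)).

Lemma is_derive_boundary_term (N : nat) (s : R) :
  sin s <> 0 -> is_derive (boundary_term N) s (boundary_term_deriv N s).
Proof.
  intros Hs; unfold boundary_term, boundary_term_deriv.
  generalize (pos_INR N); intros HN.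
  auto_derive; [exact Hs|field; split; [lra|exact Hs]].
Qed.

(* Integration by parts on the oscillating part of the difference: what is left
   is the arcsine remainder and a term of order 1/N. *)
Lemma kernel_difference_add_deriv (N : nat) (s : R) :
  0 < s <= PI / 2 ->
  Rabs (kernel_difference N s + boundary_term_deriv N s)
    <= 6 * ((2 * INR N + 3) * wallis (S N)) * cos s * sin s ^ (2 * N + 1)
       + 6 / (2 * INR N + 2).
Proof.
  intros Hs.
  assert (Hsin : 0 < sin s) by (apply sin_gt_0; generalize PI_RGT_0; lra).
  rewrite kernel_difference_eq by lra; unfold boundary_term_deriv.
  generalize (pos_INR N) (arcsin_remainder_coeff_pos N); intros HN Hc.
  set (c := (2 * INR N + 3) * wallis (S N)) in *.
  set (m := 2 * INR N + 2); assert (Hm : 0 < m) by (unfold m; lra).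
  set (v := ((PI / 2 - s) * (sin s - s * cos s) - s * sin s) / sin s ^ 2).
  replace (_ + _) with ((PI / 2 - s) * arcsin_remainder N s / sin s
                         + v * (sin (m * s) / m)) by (field; lra).
  destruct (arcsin_remainder_bounds N s ltac:(lra)) as [Hr0 Hr1]; fold c in Hr1.
  destruct (sin_cos_pos s ltac:(lra)) as [_ Hcos].
  generalize PI_4 (le_3_sin s ltac:(lra)) (compl_le_3_cos s ltac:(lra)); intros HPI H3 H3'.
  eapply Rle_trans; [apply Rabs_triang|apply Rplus_le_compat].
  - assert (Hq : 0 <= arcsin_remainder N s / sin s <= c * s * sin s ^ (2 * N + 1)).
    { split; [apply Rle_div_r|apply Rle_div_l]; try lra.
      replace (c * s * sin s ^ (2 * N + 1) * sin s)
        with (c * s * sin s ^ (2 * N + 2)); [lra|].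
      replace (2 * N + 2)%nat with (S (2 * N + 1)) by lia; simpl; ring. }
    assert (Hp : 0 < sin s ^ (2 * N + 1)) by (apply pow_lt, Hsin).
    assert (Hq2 : c * s * sin s ^ (2 * N + 1) <= 2 * c * sin s ^ (2 * N + 1)).
    { replace (c * s * sin s ^ (2 * N + 1)) with (s * (c * sin s ^ (2 * N + 1))) by ring.
      rewrite Rmult_assoc; apply Rmult_le_compat_r; [|lra].
      apply Rmult_le_pos; lra. }
    replace ((PI / 2 - s) * arcsin_remainder N s / sin s)
      with ((PI / 2 - s) * (arcsin_remainder N s / sin s)) by (field; lra).
    rewrite Rabs_pos_eq by (apply Rmult_le_pos; lra).
    (* The factor cos s, obtained from PI / 2 - s <= 3 cos s, makes the bound a multiple of the
       derivative of sin^(2N+2), so that integration gains a factor 1/(2N+2). *)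
    replace (6 * c * cos s * sin s ^ (2 * N + 1))
      with ((3 * cos s) * (2 * c * sin s ^ (2 * N + 1))) by ring.
    apply Rmult_le_compat; lra.
  (* The numerator of [v] is a quantity in [0, 6 sin^2 s] minus one in [0, 3 sin^2 s]. The first
     uses sin s - s cos s <= s (1 - cos s). *)
  - assert (Hv : Rabs v <= 6).
    { generalize (sin_ge_mul_cos s ltac:(lra)) (one_sub_cos_le_sin s ltac:(lra))
        (sin_lt_x s (proj1 Hs)); intros Ha Hb Hx.
      assert (Hs2 : 0 < sin s ^ 2) by (apply pow_lt, Hsin).
      assert (H1 : 0 <= sin s - s * cos s <= 3 * sin s ^ 2).
      { split; [lra|].
        assert (s * (1 - cos s) <= 3 * sin s * sin s) by (apply Rmult_le_compat; lra).
        simpl; lra. }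
      assert (H2 : 0 <= s * sin s <= 3 * sin s ^ 2).
      { split; [apply Rmult_le_pos; lra|simpl; nra]. }
      apply Rabs_le; unfold v; split; [apply Rle_div_r|apply Rle_div_l]; nra. }
    unfold Rdiv; rewrite !Rabs_mult, (Rabs_pos_eq (/ m))
      by (left; apply Rinv_0_lt_compat, Hm).
    rewrite <- Rmult_assoc; apply Rmult_le_compat_r;
      [left; apply Rinv_0_lt_compat, Hm|].
    assert (Rabs (sin (m * s)) <= 1) by (apply Rabs_le, SIN_bound).
    generalize (Rabs_pos v) (Rabs_pos (sin (m * s))); intros; nra.
Qed.

(** The interval is split at [e] = 1/(N+1). The uniform bound gives 12e on the left. On the right,
    integration by parts gives 3e from the boundary term at [e] (it vanishes at PI / 2) and at most
    9 w_(N+1) + 6e from the error bound. *)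
Lemma kernel_difference_integral_bound (N : nat) (l : R) :
  is_RInt (kernel_difference N) 0 (PI / 2) l ->
  Rabs l <= 21 * / (INR N + 1) + 9 * wallis (S N).
Proof.
  intros Hl.
  generalize (pos_INR N) (wallis_pos (S N)) (arcsin_remainder_coeff_pos N);
    intros HN Hw Hc.
  generalize PI2_1 PI_4; intros HPI1 HPI4.
  set (e := / (INR N + 1)).
  assert (He : 0 < e <= 1).
  { unfold e; split; [apply Rinv_0_lt_compat; lra|].
    rewrite <- Rinv_1; apply Rinv_le_contravar; lra. }
  set (c := (2 * INR N + 3) * wallis (S N)) in *.
  set (m := 2 * INR N + 2); assert (Hm : 0 < m) by (unfold m; lra).
  assert (Hme : / m = e / 2) by (unfold m, e; field; lra).
  assert (Hex : ex_RInt (kernel_difference N) 0 (PI / 2)) by (exists l; exact Hl).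
  destruct (ex_RInt_Chasles_1 (kernel_difference N) 0 e (PI / 2) ltac:(lra) Hex)
    as [l1 Hl1].
  destruct (ex_RInt_Chasles_2 (kernel_difference N) 0 e (PI / 2) ltac:(lra) Hex)
    as [l2 Hl2].
  assert (E : l = l1 + l2).
  { rewrite <- (is_RInt_unique _ _ _ _ Hl).
    apply is_RInt_unique, (is_RInt_Chasles _ _ _ _ _ _ Hl1 Hl2). }
  assert (Hsin : forall s, e <= s <= PI / 2 -> 0 < sin s)
    by (intros s Hs; apply sin_gt_0; lra).
  assert (B1 : Rabs l1 <= 12 * e).
  { apply Rabs_le; split.
    - assert (H := is_RInt_le _ _ 0 e _ _ ltac:(lra) (is_RInt_const 0 e (-12)) Hl1).
      unfold scal in H; simpl in H; unfold mult in H; simpl in H.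
      enough ((e - 0) * -12 <= l1) by lra.
      apply H; intros s Hs; apply kernel_difference_le_12; lra.
    - assert (H := is_RInt_le _ _ 0 e _ _ ltac:(lra) Hl1 (is_RInt_const 0 e 12)).
      unfold scal in H; simpl in H; unfold mult in H; simpl in H.
      enough (l1 <= (e - 0) * 12) by lra.
      apply H; intros s Hs; apply kernel_difference_le_12; lra. }
  set (b := boundary_term N).
  assert (HB : is_RInt (boundary_term_deriv N) e (PI / 2) (b (PI / 2) - b e)).
  { apply (is_RInt_antiderivative b); [lra|easy| |].
    - intros s Hs; apply is_derive_boundary_term.
      generalize (Hsin s Hs); lra.
    - intros s Hs; generalize (Hsin s Hs); intros.
      unfold boundary_term_deriv; auto_derive; repeat split; try lra; nra. }
  (* [G] is an antiderivative of [g], the pointwise bound of [kernel_difference_add_deriv]. *)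
  set (G := fun s => c * (6 * sin s ^ (2 * N + 2) / m) + 6 / m * s).
  set (g := fun s => 6 * c * cos s * sin s ^ (2 * N + 1) + 6 / m).
  assert (HG : is_RInt g e (PI / 2) (G (PI / 2) - G e)).
  { apply (is_RInt_antiderivative G); [lra|easy| |].
    - intros s _; unfold G, g.
      assert (Em : m = INR (2 * N + 2))
        by (unfold m; rewrite plus_INR, mult_INR; simpl; ring).
      revert Em; replace (2 * N + 1)%nat with (Init.Nat.pred (2 * N + 2)) by lia.
      generalize (2 * N + 2)%nat; intros q Em.
      auto_derive; [easy|rewrite <- Em; field; lra].
    - intros s _; unfold g; auto_derive; easy. }
  assert (Hsum := is_RInt_plus _ _ _ _ _ _ Hl2 HB).
  assert (B2 : Rabs (l2 + (b (PI / 2) - b e)) <= G (PI / 2) - G e).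
  { apply Rabs_le; split.
    - apply (is_RInt_le _ _ e (PI / 2) _ _ ltac:(lra) (is_RInt_opp _ _ _ _ HG) Hsum).
      intros s Hs; assert (H := kernel_difference_add_deriv N s ltac:(lra)).
      apply Rabs_le_between in H; apply H.
    - apply (is_RInt_le _ _ e (PI / 2) _ _ ltac:(lra) Hsum HG).
      intros s Hs; assert (H := kernel_difference_add_deriv N s ltac:(lra)).
      apply Rabs_le_between in H; apply H. }
  assert (Hb0 : b (PI / 2) = 0)
    by (unfold b, boundary_term; rewrite sin_PI2; unfold Rdiv; ring).
  assert (Hbe : Rabs (b e) <= 3 * e).
  { generalize (Hsin e ltac:(lra)) (le_3_sin e ltac:(lra)); intros Hse H3.
    unfold b, boundary_term; fold m.
    assert (Hq : 0 <= (PI / 2 - e) * e / sin e <= 6).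
    { split; [apply Rle_div_r|apply Rle_div_l]; nra. }
    assert (Rabs (sin (m * e)) <= 1) by (apply Rabs_le, SIN_bound).
    replace (sin (m * e) / m) with (sin (m * e) * (e / 2))
      by (rewrite <- Hme; easy).
    rewrite !Rabs_mult, (Rabs_pos_eq (e / 2)), Rabs_pos_eq by lra.
    generalize (Rabs_pos (sin (m * e))); intros.
    replace (3 * e) with (6 * (1 * (e / 2))) by field.
    apply Rmult_le_compat; [lra|apply Rmult_le_pos; lra|lra|].
    apply Rmult_le_compat_r; lra. }
  assert (HGb : G (PI / 2) - G e <= 9 * wallis (S N) + 6 * e).
  { unfold G; rewrite sin_PI2, pow1.
    unfold Rdiv; rewrite Hme.
    assert (0 < sin e ^ (2 * N + 2)) by (apply pow_lt, Hsin; lra).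
    assert (0 <= c * (6 * sin e ^ (2 * N + 2) * (e / 2)))
      by (apply Rmult_le_pos; [lra|]; apply Rmult_le_pos; [apply Rmult_le_pos|]; lra).
    assert (c * e <= 3 * wallis (S N)).
    { assert (Ee : (INR N + 1) * e = 1) by (unfold e; field; lra).
      unfold c; replace ((2 * INR N + 3) * wallis (S N) * e)
        with (wallis (S N) * (2 * ((INR N + 1) * e) + e)) by ring.
      rewrite Ee; nra. }
    nra. }
  apply Rabs_le_between in B1; apply Rabs_le_between in B2.
  apply Rabs_le_between in Hbe; rewrite Hb0 in B2.
  apply Rabs_le; lra.
Qed.

(** * Evaluation of the series *)

Lemma is_lim_seq_is_series (a : nat -> R) (l : R) :
  is_lim_seq (sum_n a) l -> is_series a l.
Proof. intros H; exact H. Qed.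

(** A majorant for the series of zeta(3) and of Catalan's constant. The factor 2 makes its first
    term 1, which equals theirs. *)
Lemma is_series_telescoping : is_series (fun n => 2 / ((INR n + 1) * (INR n + 2))) 2.
Proof.
  apply is_lim_seq_is_series, (is_lim_seq_ext (fun n => 2 - 2 * / (1 * INR n + 2))).
  - intros n; induction n as [|n IH].
    + rewrite sum_O; simpl; field.
    + rewrite sum_n_S, <- IH, S_INR; generalize (pos_INR n); intros; field; lra.
  - replace (Finite 2) with (Finite (2 - 2 * 0)) by (apply f_equal; ring).
    apply is_lim_seq_minus'; [apply is_lim_seq_const|].
    apply (is_lim_seq_scal_l _ 2 0), is_lim_seq_inv_INR; lra.
Qed.

Lemma ex_series_dominated (a : nat -> R) :
  (forall n, Rabs (a n) <= 2 / ((INR n + 1) * (INR n + 2))) -> ex_series a.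
Proof.
  intros Ha; apply (ex_series_le a _ Ha); exists 2; apply is_series_telescoping.
Qed.

Lemma ex_series_zeta3 : ex_series (fun n => 1 / INR (S n) ^ 3).
Proof.
  apply ex_series_dominated; intros n; rewrite S_INR.
  generalize (pos_INR n); intros Hn.
  assert (0 < (INR n + 1) ^ 3) by (apply pow_lt; lra).
  rewrite Rabs_pos_eq by (apply Rdiv_le_0_compat; lra).
  apply (Rle_div_r _ 2); [apply Rmult_lt_0_compat; lra|].
  replace (1 / (INR n + 1) ^ 3 * ((INR n + 1) * (INR n + 2)))
    with ((INR n + 2) / (INR n + 1) ^ 2) by (field; lra).
  apply Rle_div_l; [apply pow_lt; lra|nra].
Qed.

Lemma is_series_Catalan : is_series (fun n => (-1) ^ n / (2 * INR n + 1) ^ 2) Catalan.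
Proof.
  apply Series_correct, ex_series_dominated; intros n.
  generalize (pos_INR n); intros Hn.
  assert (Hm : 0 < (2 * INR n + 1) ^ 2) by (apply pow_lt; lra).
  unfold Rdiv at 1; rewrite Rabs_mult, pow_1_abs, Rmult_1_l.
  rewrite Rabs_pos_eq by (left; apply Rinv_0_lt_compat, Hm).
  apply (Rle_div_r _ 2); [apply Rmult_lt_0_compat; lra|].
  rewrite Rmult_comm; apply Rle_div_l; nra.
Qed.

(** The odd numbers up to 2N+1 are the integers from 1 to 2N+2 without the even ones, whose inverse
    cubes carry the factor 1/8. The shifted index makes 2N+1 the last index of the full sum. *)
Lemma sum_odd_cubes (N : nat) :
  sum_n (fun k => / (2 * INR k + 1) ^ 3) N
  = sum_n (fun k => 1 / INR (S k) ^ 3) (2 * N + 1)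
    - / 8 * sum_n (fun k => 1 / INR (S k) ^ 3) N :> R.
Proof.
  induction N as [|N IH].
  - change (2 * 0 + 1)%nat with 1%nat; rewrite sum_n_S, !sum_O; simpl; field.
  - replace (2 * S N + 1)%nat with (S (S (2 * N + 1))) by lia.
    rewrite !sum_n_S, IH, !S_INR, plus_INR, mult_INR; simpl (INR 2); simpl (INR 1).
    generalize (pos_INR N); intros; field; lra.
Qed.

Lemma is_series_odd_cubes : is_series (fun k => / (2 * INR k + 1) ^ 3) (7 / 8 * zeta3).
Proof.
  assert (Hz : is_lim_seq (sum_n (fun k => 1 / INR (S k) ^ 3)) zeta3)
    by apply (Series_correct _ ex_series_zeta3).
  apply is_lim_seq_is_series, (is_lim_seq_ext _ _ _ (fun N => eq_sym (sum_odd_cubes N))).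
  replace (Finite (7 / 8 * zeta3)) with (Finite (zeta3 - / 8 * zeta3))
    by (apply f_equal; field).
  apply is_lim_seq_minus'.
  - apply (is_lim_seq_subseq _ _ (fun N => (2 * N + 1)%nat)); [|exact Hz].
    apply eventually_subseq; intros n; lia.
  - apply (is_lim_seq_scal_l _ (/ 8) zeta3), Hz.
Qed.

(** The partial sums of [A] and [B] differ by the integral of [kernel_difference], which tends to 0,
    so [B] has the limit of [A]. *)
Lemma is_series_wallis_sq :
  is_series (fun n => wallis n ^ 2 / (2 * INR n + 1)) (7 / 2 * zeta3 - PI * Catalan).
Proof.
  set (A := fun k => 4 * / (2 * INR k + 1) ^ 3 - PI * ((-1) ^ k / (2 * INR k + 1) ^ 2)).
  set (B := fun n => wallis n ^ 2 / (2 * INR n + 1)).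
  assert (HA : is_lim_seq (sum_n A) (7 / 2 * zeta3 - PI * Catalan)).
  { replace (7 / 2 * zeta3) with (4 * (7 / 8 * zeta3)) by field.
    exact (is_series_minus _ _ _ _ (is_series_scal 4 _ _ is_series_odd_cubes)
             (is_series_scal PI _ _ is_series_Catalan)). }
  assert (HAB : is_lim_seq (fun N => sum_n A N - sum_n B N) 0).
  { apply is_lim_seq_abs_0.
    apply (is_lim_seq_le_le (fun _ => 0) _
             (fun N => 21 * / (1 * INR N + 1) + 9 * wallis (S N))).
    - intros N; split; [apply Rabs_pos|].
      rewrite Rmult_1_l; apply kernel_difference_integral_bound.
      exact (is_RInt_minus _ _ _ _ _ _ (is_RInt_sine_series N) (is_RInt_arcsin_series N)).
    - apply is_lim_seq_const.
    - replace (Finite 0) with (Finite (21 * 0 + 9 * 0)) by (apply f_equal; ring).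
      apply is_lim_seq_plus'.
      + apply (is_lim_seq_scal_l _ 21 0), is_lim_seq_inv_INR; lra.
      + apply (is_lim_seq_scal_l _ 9 0), (is_lim_seq_incr_1 wallis), is_lim_wallis. }
  apply is_lim_seq_is_series, (is_lim_seq_ext (fun N => sum_n A N - (sum_n A N - sum_n B N))).
  - intros N; ring.
  - rewrite <- (Rminus_0_r (_ - _)); apply is_lim_seq_minus'; assumption.
Qed.

(** With T_n = (6n+5) w_n^2, each term w_n^2 / (2n+3)^3 equals w_(n+1)^2 / (2n+3) + T_(n+1) - T_n.
    The constant 6 is T_0 = 5 plus the term 1 of index 0 added to the sum. T is written as 3 (2n+1)
    w_n^2 + 2 w_n^2 because both parts have known limits. *)
Lemma sum_binom_term (N : nat) :
  sum_n binom_term N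
  = sum_n (fun n => wallis n ^ 2 / (2 * INR n + 1)) (S N) - 6
    + (3 * ((2 * INR (S N) + 1) * wallis (S N) ^ 2) + 2 * wallis (S N) ^ 2) :> R.
Proof.
  induction N as [|N IH].
  - rewrite sum_n_S, !sum_O, binom_term_wallis, wallis_S, wallis_0; simpl; field.
  - rewrite sum_n_S, IH, (sum_n_S _ (S N)), binom_term_wallis, (wallis_S (S N)), !S_INR.
    generalize (pos_INR N); intros; field; lra.
Qed.

Lemma is_series_binom_term :
  is_series binom_term (/ 2 * (7 * zeta3 + (3 - 2 * Catalan) * PI - 12)).
Proof.
  apply is_lim_seq_is_series, (is_lim_seq_ext _ _ _ (fun N => eq_sym (sum_binom_term N))).
  replace (Finite (/ 2 * (7 * zeta3 + (3 - 2 * Catalan) * PI - 12)))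
    with (Finite (7 / 2 * zeta3 - PI * Catalan - 6 + (3 * (PI / 2) + 2 * 0)))
    by (apply f_equal; field).
  apply is_lim_seq_plus'; [apply is_lim_seq_minus'|apply is_lim_seq_plus'].
  - apply (is_lim_seq_incr_1 (sum_n _)), is_series_wallis_sq.
  - apply is_lim_seq_const.
  - apply (is_lim_seq_scal_l _ 3 (PI / 2)),
      (is_lim_seq_incr_1 (fun n => (2 * INR n + 1) * wallis n ^ 2)), is_lim_wallis_sq.
  - apply (is_lim_seq_scal_l _ 2 0),
      (is_lim_seq_incr_1 (fun n => wallis n ^ 2)), is_lim_wallis_sq_0.
Qed.

(* [Series] is total, so the convergence implicit in writing the two infinite
   sums is asserted explicitly. *)
Theorem theorem1 :
  ex_series (hyp4F3_term 1 1 1 (3/2) (5/2) (5/2) (5/2) 1) /\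
  ex_series binom_term /\
  hyp4F3 1 1 1 (3/2) (5/2) (5/2) (5/2) 1 = 27 * Series binom_term /\
  27 * Series binom_term
    = 27 / 2 * (7 * zeta3 + (3 - 2 * Catalan) * PI - 12).
Proof.
  assert (Hex : ex_series binom_term) by (eexists; apply is_series_binom_term).
  split; [|split; [exact Hex|split]].
  - apply (ex_series_ext (fun n => 27 * binom_term n)).
    + intros n; symmetry; apply hyp4F3_term_binom_term.
    + exact (ex_series_scal (V := R_NormedModule) 27 _ Hex).
  - unfold hyp4F3; rewrite <- Series_scal_l.
    apply Series_ext, hyp4F3_term_binom_term.
  - rewrite (is_series_unique _ _ is_series_binom_term); field.
Qed.
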